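(* If $n$ is an integer with $n\ge 5$, then $\operatorname{ar}(n,F_5)=1+\lfloor n/3\rfloor$.
   Context: $F_5$ is the $3$-uniform hypergraph $\{abc,abd,cde\}$ on five distinct vertices $a,b,c,d,e$. $K_n^{(3)}$ is the complete $3$-uniform hypergraph on $n$ vertices. An edge-coloring is a surjection from the edge set onto a set of colors; a copy of $F_5$ is rainbow if its three edges receive pairwise distinct colors. $\operatorname{ar}(n,F_5)$ is the maximum number of colors in an edge-coloring of $K_n^{(3)}$ containing no rainbow copy of $F_5$. *)

(* Defs.v *)
From mathcomp Require Import all_boot.

Set Implicit Arguments.
Unset Strict Implicit.
Unset Printing Implicit Defensive.

(* A hypergraph on the vertex type V is given by its edge set F : {set {set V}}. *)

Definition complete3 (n : nat) : {set {set 'I_n}} := [set e : {set 'I_n} | #|e| == 3].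

Definition F5 : {set {set 'I_5}} :=
  let a := @Ordinal 5 0 isT in
  let b := @Ordinal 5 1 isT in
  let c := @Ordinal 5 2 isT in
  let d := @Ordinal 5 3 isT in
  let e := @Ordinal 5 4 isT in
  [set [set a; b; c]; [set a; b; d]; [set c; d; e]].

(* A coloring is a function on all subsets of 'I_n, but only its values on    *)
(* edges of complete3 n matter: surjectivity is required from these edges,    *)
(* and copies of a 3-uniform F only involve these edges.                      *)
Definition edge_coloring (n k : nat) (c : {ffun {set 'I_n} -> 'I_k}) : bool :=
  [forall i : 'I_k, exists e : {set 'I_n} in complete3 n, c e == i].

(* A copy of F in the complete hypergraph is the image of F under an          *)
(* injection phi of the vertices; it is not required to be induced.           *)
Definition rainbow_copy (n k : nat) (V : finType) (F : {set {set V}})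
    (c : {ffun {set 'I_n} -> 'I_k}) (phi : {ffun V -> 'I_n}) : bool :=
  injectiveb phi &&
  [forall e1 in F, forall e2 in F, (e1 != e2) ==> (c (phi @: e1) != c (phi @: e2))].

Definition has_rainbow_free_coloring (n : nat) (V : finType)
    (F : {set {set V}}) (k : nat) : bool :=
  [exists c : {ffun {set 'I_n} -> 'I_k},
     edge_coloring c && ~~ [exists phi : {ffun V -> 'I_n}, rainbow_copy F c phi]].

(* The range of k loses nothing, as a surjection uses at most one color per   *)
(* edge (see ar_max and ar_attained).                                         *)
Definition ar (n : nat) (V : finType) (F : {set {set V}}) : nat :=
  \max_(k < #|complete3 n|.+1 | has_rainbow_free_coloring n F k) k.

Lemma ar_max n (V : finType) (F : {set {set V}}) k :
  has_rainbow_free_coloring n F k -> k <= ar n F.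
Proof.
move=> Hk; have lek : k < #|complete3 n|.+1.
  case/existsP: Hk => c /andP[/forallP surj _]; rewrite ltnS.
  rewrite -[leqLHS]card_ord -cardsT.
  apply: leq_trans (leq_imset_card c (complete3 n)).
  apply/subset_leq_card/subsetP => i _.
  by have /exists_inP[e eE /eqP <-] := surj i; apply: imset_f.
exact: (@leq_bigmax_cond _ _ (fun k : 'I__ => k : nat) (Ordinal lek)).
Qed.

Lemma ar_attained n (V : finType) (F : {set {set V}}) :
  3 <= n -> 1 < #|F| -> has_rainbow_free_coloring n F (ar n F).
Proof.
move=> n3 F2.
have E3 : 0 < #|complete3 n|.
  by rewrite /complete3 card_draws card_ord bin_gt0.
have H1 : has_rainbow_free_coloring n F 1.
  have [e eE] := card_gt0P E3.
  apply/existsP; exists [ffun=> ord0]; apply/andP; split.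
    apply/forallP => i; apply/exists_inP; exists e => //.
    by rewrite ffunE [i]ord1.
  apply/existsP => -[phi /andP[_ /forall_inP H]].
  have [x [y [xF yF xy]]] := card_gt1P F2.
  by have /forall_inP/(_ y yF) := H x xF; rewrite xy !ffunE eqxx.
rewrite /ar; have lt1 : 1 < #|complete3 n|.+1 by [].
by case: (@eq_bigmax_cond _ [pred k : 'I_(#|complete3 n|.+1) |
  has_rainbow_free_coloring n F k] (fun k => k : nat)) =>
  [|k Hk ->] //; apply/card_gt0P; exists (Ordinal lt1).
Qed.

Lemma card_F5 : #|F5| = 3.
Proof.
rewrite /F5 /= -setUA cardsU1 cards2 !inE negb_or.
have neq (A B : {set 'I_5}) x : x \in A -> x \notin B -> A != B.
  by move=> xA xB; apply: contraNneq xB => <-.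
rewrite (neq _ _ (@Ordinal 5 2 isT)) ?inE //.
rewrite (neq _ _ (@Ordinal 5 0 isT)) ?inE //.
by rewrite (neq _ _ (@Ordinal 5 0 isT)) ?inE.
Qed.

(* Main.v *)
Require Import Defs.
From mathcomp Require Import all_boot.

(** Upper bound. The three triples of F5 live on five vertices, and a coloring of
    triples without rainbow F5 turns out to have at most two colors on every set
    of five vertices ([two_colors_of_card5]). From this, as soon as two
    triples of different colors i and j intersect, some vertex lies only in
    triples of color i or j ([bicolored_vertex]). Since three vertices
    always lie in a common triple, the color pairs obtained in this way, taken
    three at a time, have a common color, so they form a star: one color z
    belongs to all of them ([dominant_color]). Hence triples of two different
    colors other than z are disjoint. Choosing one triple for each color other
    than z gives a matching of k - 1 triples in n vertices, where k is the number
    of colors, so k - 1 <= n / 3 ([rainbowF5_free_card]).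

    Lower bound. The triples of a matching of size n / 3 get pairwise different
    colors, and all remaining triples one further color. The triples of F5 pairwise
    intersect, so a copy contains at most one triple of the matching and is not
    rainbow ([matching_coloring]). *)

Set Implicit Arguments.
Unset Strict Implicit.
Unset Printing Implicit Defensive.

(** * Small sets *)

Lemma set3_swap (T : finType) (a b c : T) : [set a; b; c] = [set b; a; c].
Proof. by rewrite (setUC [set a]). Qed.

Lemma set3_rot (T : finType) (a b c : T) : [set a; b; c] = [set b; c; a].
Proof. by apply/setP => x; rewrite !inE; do 3!case: (x == _). Qed.

Lemma cards3 (T : finType) (a b c : T) : uniq [:: a; b; c] -> #|[set a; b; c]| = 3.
Proof.
move=> U; rewrite -[3]/(size [:: a; b; c]) -(card_uniqP U); apply: eq_card => x.
by rewrite !inE orbA.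
Qed.

Lemma sub3set (T : finType) (A : {set T}) x y z :
  x \in A -> y \in A -> z \in A -> [set x; y; z] \subset A.
Proof. by move=> xA yA zA; rewrite !subUset !sub1set xA yA zA. Qed.

(** Reduces a statement about all triples of five points to the ten sublists
    of length three. *)
Lemma triple_in5 (T : finType) (a b c d e : T) (g : {set T}) :
    #|g| = 3 -> g \subset [set a; b; c; d; e] ->
  exists x y z, [/\ subseq [:: x; y; z] [:: a; b; c; d; e] & g = [set x; y; z]].
Proof.
move=> g3 gS.
pose s := [seq x <- undup [:: a; b; c; d; e] | x \in g].
have gE : g =i s.
  move=> x; rewrite mem_filter mem_undup; case: (boolP (x \in g)) => //= xg.
  by have := subsetP gS x xg; rewrite !inE -!orbA => ->.
have : size s = 3.
  by rewrite -g3 (eq_card gE); apply/esym/card_uniqP; rewrite filter_uniq ?undup_uniq.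
have : subseq s [:: a; b; c; d; e].
  by apply: subseq_trans (undup_subseq _); apply: filter_subseq.
move: gE; case: s => [|x [|y [|z []]]] // gE sub _; exists x, y, z; split=> //.
by apply/setP => u; rewrite gE !inE orbA.
Qed.

Lemma setI_full_eq (T : finType) (A B : {set T}) k :
  #|A| = k -> #|B| = k -> #|A :&: B| = k -> A = B.
Proof.
move=> Ak Bk ABk; transitivity (A :&: B); last first.
  by apply/eqP; rewrite eqEcard subsetIr ABk Bk leqnn.
by apply/esym/eqP; rewrite eqEcard subsetIl ABk Ak leqnn.
Qed.

Lemma ex_superset (T : finType) (A : {set T}) k :
  #|A| <= k <= #|T| -> exists2 B : {set T}, A \subset B & #|B| = k.
Proof.
elim: k => [|k IHk] /andP[Ak kT].
  by exists A => //; apply/eqP; rewrite -leqn0.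
move: Ak; rewrite leq_eqVlt ltnS => /orP[/eqP Ak | Ak]; first by exists A.
have [|B AB Bk] := IHk; first by rewrite Ak ltnW.
have [x xB] : exists x, x \notin B.
  apply/existsP; rewrite -negb_forall; apply: contraL kT => /forallP allB.
  by rewrite -leqNgt -Bk; apply/subset_leq_card/subsetP => x _; apply: allB.
by exists (x |: B); rewrite ?cardsU1 ?xB ?Bk //; apply: subset_trans AB (subsetUr _ _).
Qed.

(** Closes goals that become propositional once every comparison of vertices is
    treated as an unknown boolean. *)
Ltac case_vertices :=
  repeat match goal with
  | |- context [?x == ?y] => case: (x == y)
  | |- context [nat_of_bool (?p ?y)] => case: (p y)
  end; done.

Ltac permute_vertices :=
  (apply/permP => ? || apply/setP => ?); rewrite /= ?inE; case_vertices.

Lemma skew_pair_meet (V : finType) (a b c d e : V) :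
  uniq [:: a; b; c; d; e] -> #|[set a; b; c] :&: [set c; d; e]| = 1.
Proof.
move=> U; apply/eqP/cards1P; exists c; apply/setP => x; rewrite !inE.
have [->|xc] := eqVneq x c; first by rewrite orbT.
rewrite !orbF /=; apply/negbTE/negP => /andP[/orP[]/eqP-> /orP[]/eqP E];
  by move: U; rewrite E /= !inE eqxx ?orbT ?andbF.
Qed.

Lemma skew_pair_names (V : finType) (e f : {set V}) :
    #|e| = 3 -> #|f| = 3 -> #|e :&: f| = 1 ->
  exists a b c d e', [/\ uniq [:: a; b; c; d; e'],
    e = [set a; b; c] & f = [set c; d; e']].
Proof.
move=> e3 f3 /eqP/cards1P[c efc].
have /setIP[ce cf] : c \in e :&: f by rewrite efc set11.
have /eqP/cards2P[a [b [ab eE]]] : #|e :\ c| = 2.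
  by apply/eqP; rewrite -eqSS -e3 [#|e|](cardsD1 c) ce.
have /eqP/cards2P[d [e' [de fE]]] : #|f :\ c| = 2.
  by apply/eqP; rewrite -eqSS -f3 [#|f|](cardsD1 c) cf.
have /setD1P[ac ae] : a \in e :\ c by rewrite eE !inE eqxx.
have /setD1P[bc be] : b \in e :\ c by rewrite eE !inE eqxx orbT.
have /setD1P[dc df] : d \in f :\ c by rewrite fE !inE eqxx.
have /setD1P[ec ef] : e' \in f :\ c by rewrite fE !inE eqxx orbT.
have fNe x y : x \in e -> x != c -> y \in f -> x != y.
  move=> xe xc yf; apply: contraNneq xc => xy.
  by rewrite -in_set1 -efc inE xe xy.
exists a, b, c, d, e'; split.
- rewrite /= !inE !negb_or ab ac bc de (fNe a d) // (fNe a e') // (fNe b d) //.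
  by rewrite (fNe b e') // ![c == _]eq_sym dc ec.
- by rewrite setUC -eE setD1K.
- by rewrite -setUA -fE setD1K.
Qed.

Lemma close_pair_names (V : finType) (e f : {set V}) :
    #|e| = 3 -> #|f| = 3 -> #|e :&: f| = 2 ->
  exists a b c d, [/\ uniq [:: a; b; c; d],
    e = [set a; b; c] & f = [set a; b; d]].
Proof.
move=> e3 f3 ef2.
have /eqP/cards1P[c eE] : #|e :\: f| = 1 by rewrite cardsD e3 ef2.
have /eqP/cards1P[d fE] : #|f :\: e| = 1 by rewrite cardsD f3 setIC ef2.
have /cards2P[a [b [ab efE]]] : #|e :&: f| == 2 by rewrite ef2.
have /setIP[ae af] : a \in e :&: f by rewrite efE !inE eqxx.
have /setIP[be bf] : b \in e :&: f by rewrite efE !inE eqxx orbT.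
have /setDP[ce cNf] : c \in e :\: f by rewrite eE set11.
have /setDP[df dNe] : d \in f :\: e by rewrite fE set11.
exists a, b, c, d; split.
- rewrite /= !inE !negb_or ab (memPn cNf a af) (memPn cNf b bf).
  by rewrite (memPn dNe a ae) (memPn dNe b be) (memPn dNe c ce).
- by rewrite -efE -eE setID.
- by rewrite -efE -fE setIC setID.
Qed.

(** * Colorings of triples without a rainbow F5 *)

(** Over an arbitrary vertex type and an arbitrary set of colors, so that the
    local arguments apply to any coloring of triples. *)
Definition rainbowF5_free (V : finType) (K : Type) (col : {set V} -> K) : Prop :=
  forall a b c d e : V, uniq [:: a; b; c; d; e] ->
    [\/ col [set a; b; c] = col [set a; b; d],
        col [set a; b; c] = col [set c; d; e] |
        col [set a; b; d] = col [set c; d; e]].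

Lemma rainbowF5_freeP n k (col : {ffun {set 'I_n} -> 'I_k}) :
  reflect (rainbowF5_free col)
          (~~ [exists phi : {ffun 'I_5 -> 'I_n}, rainbow_copy F5 col phi]).
Proof.
apply: (iffP idP) => [norb a b c d e U | free].
  have inj : injective (nth a [:: a; b; c; d; e] \o @nat_of_ord 5).
    move=> i j /= /eqP; rewrite nth_uniq ?ltn_ord // => /eqP; exact: val_inj.
  suff: [|| col [set a; b; c] == col [set a; b; d],
            col [set a; b; c] == col [set c; d; e] |
            col [set a; b; d] == col [set c; d; e]].
    by case/or3P => /eqP E; [constructor 1 | constructor 2 | constructor 3].
  apply: contraR norb; rewrite !negb_or => /and3P[n12 n13 n23].
  apply/existsP; exists (finfun (nth a [:: a; b; c; d; e] \o @nat_of_ord 5)).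
  apply/andP; split.
    by apply/injectiveP => i j; rewrite !ffunE; apply: inj.
  apply/forall_inP => e1; rewrite !inE => e1F; apply/forall_inP => e2.
  rewrite !inE => e2F; apply/implyP.
  case/orP: e1F => [/orP[]|] /eqP->; case/orP: e2F => [/orP[]|] /eqP->;
    rewrite ?eqxx // => _; rewrite !imsetU !imset_set1 !ffunE //=;
    by rewrite eq_sym.
apply/existsP => -[phi /andP[/injectiveP inj /forall_inP rb]].
pose v i lt_i5 := @Ordinal 5 i lt_i5.
have U : uniq [:: phi (v 0 isT); phi (v 1 isT); phi (v 2 isT);
                  phi (v 3 isT); phi (v 4 isT)].
  exact: (etrans (map_inj_uniq inj [:: v 0 isT; v 1 isT; v 2 isT; v 3 isT; v 4 isT])).
have neq (A B : {set 'I_5}) x : x \in A -> x \notin B -> A != B.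
  by move=> xA xB; apply: contraNneq xB => <-.
have rbE A B : A \in F5 -> B \in F5 -> A != B -> col (phi @: A) <> col (phi @: B).
  by move=> AF BF AB; apply/eqP; move/forall_inP/(_ B BF)/implyP: (rb A AF); apply.
have := free _ _ _ _ _ U; rewrite -!imset_set1 -!imsetU.
case; apply: rbE; rewrite ?inE ?eqxx ?orbT //.
- by apply: (neq _ _ (v 2 isT)); rewrite ?inE.
- by apply: (neq _ _ (v 0 isT)); rewrite ?inE.
- by apply: (neq _ _ (v 0 isT)); rewrite ?inE.
Qed.

(** * Five vertices carry at most two colors *)

(** Suppose that abc, cde and acd had three colors. The copies of F5 containing
    abe with two of these triples force abe to have the color of cde, and those
    containing bde force bde to have the color of abc; then bde, abe and acd are
    the triples of a rainbow F5. *)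
Lemma skew_pair_cross (V : finType) (K : Type) (col : {set V} -> K) a b c d e :
    rainbowF5_free col -> uniq [:: a; b; c; d; e] ->
  [\/ col [set a; b; c] = col [set c; d; e],
      col [set a; b; c] = col [set a; c; d] |
      col [set c; d; e] = col [set a; c; d]].
Proof.
move=> free U.
have copy x y z u v A B C : perm_eq [:: x; y; z; u; v] [:: a; b; c; d; e] ->
    A = [set x; y; z] -> B = [set x; y; u] -> C = [set z; u; v] ->
    [\/ col A = col B, col A = col C | col B = col C].
  by move=> /perm_uniq; rewrite U => /free + -> -> ->.
pose X := [set a; b; c]; pose Y := [set c; d; e]; pose Z := [set a; c; d].
pose W := [set a; b; e]; pose T := [set b; d; e].
have : [\/ col Y = col Z, col Y = col W | col Z = col W].
  by apply: (copy c d e a b); permute_vertices.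
have : [\/ col W = col X, col W = col Y | col X = col Y].
  by apply: (copy a b e c d); permute_vertices.
have : [\/ col X = col Z, col X = col T | col Z = col T].
  by apply: (copy a c b d e); permute_vertices.
have : [\/ col Y = col T, col Y = col X | col T = col X].
  by apply: (copy d e c b a); permute_vertices.
have : [\/ col T = col W, col T = col Z | col W = col Z].
  by apply: (copy b e d a c); permute_vertices.
move: {copy free U} (col X) (col Y) (col Z) (col W) (col T) => x y z w t.
case=> ?; case=> ?; case=> ?; case=> ?; case=> ?; subst;
  by [constructor 1 | constructor 2 | constructor 3].
Qed.

(** Two triples meeting in one vertex c determine the colors on their five
    vertices: a third triple either avoids c, and completes them to an F5, or is
    of the form treated in [skew_pair_cross]. *)
Lemma skew_pair_two_colors (V : finType) (K : Type) (col : {set V} -> K)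
    a b c d e (g : {set V}) :
    rainbowF5_free col -> uniq [:: a; b; c; d; e] ->
    #|g| = 3 -> g \subset [set a; b; c; d; e] ->
  [\/ col [set a; b; c] = col [set c; d; e],
      col [set a; b; c] = col g | col [set c; d; e] = col g].
Proof.
move=> free U g3 gS.
have three x y z u v A B : perm_eq [:: x; y; z; u; v] [:: a; b; c; d; e] ->
    A = [set x; y; z] -> B = [set z; u; v] ->
    g = [set x; y; u] \/ g = [set x; z; u] ->
  [\/ col A = col B, col A = col g | col B = col g].
  move=> /perm_uniq; rewrite U => Ux -> -> [] ->.
    by case: (free _ _ _ _ _ Ux); [constructor 2|constructor 1|constructor 3].
  exact: skew_pair_cross.
have swap A B : [\/ col B = col A, col B = col g | col A = col g] ->
    [\/ col A = col B, col A = col g | col B = col g].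
  by case; [constructor 1 | constructor 3 | constructor 2].
(* The ten triples in lexicographic order; for ade and bde, which complete cde
   rather than abc, the two given triples exchange their roles. *)
have [x [y [z []]]] := triple_in5 g3 gS => /=.
repeat (case: ifP => [/eqP->|_] //=); move=> _ gE.
- by constructor 2; rewrite gE.
- by apply: (three a b c d e); rewrite ?gE; try permute_vertices; left.
- by apply: (three a b c e d); rewrite ?gE; try permute_vertices; left.
- by apply: (three a b c d e); rewrite ?gE; try permute_vertices; right.
- by apply: (three a b c e d); rewrite ?gE; try permute_vertices; right.
- apply/swap/(three d e c a b); rewrite ?gE; try permute_vertices.
  by left; permute_vertices.
- by apply: (three b a c d e); rewrite ?gE; try permute_vertices; right.
- by apply: (three b a c e d); rewrite ?gE; try permute_vertices; right.
- apply/swap/(three d e c b a); rewrite ?gE; try permute_vertices.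
  by left; permute_vertices.
- by constructor 3; rewrite gE.
Qed.

Lemma skew_triples_two_colors (V : finType) (K : Type) (col : {set V} -> K)
    (S e f g : {set V}) :
    rainbowF5_free col -> #|S| <= 5 -> #|e| = 3 -> #|f| = 3 -> #|g| = 3 ->
    e \subset S -> f \subset S -> g \subset S -> #|e :&: f| = 1 ->
  [\/ col e = col f, col e = col g | col f = col g].
Proof.
move=> free S5 e3 f3 g3 eS fS gS ef1.
have SE : e :|: f = S.
  by apply/eqP; rewrite eqEcard subUset eS fS cardsU e3 f3 ef1.
have [a [b [c [d [e' [U eE fE]]]]]] := skew_pair_names e3 f3 ef1.
rewrite eE fE; apply: skew_pair_two_colors U g3 _ => //.
apply: subset_trans gS _; rewrite -SE eE fE; apply/subsetP => x.
by rewrite !inE; case_vertices.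
Qed.

(** This is what rainbow-freeness amounts to for the rest of the proof: any five
    vertices span at most two colors. *)
Lemma two_colors_of_card5 (V : finType) (K : Type) (col : {set V} -> K)
    (S e f g : {set V}) :
    rainbowF5_free col -> 5 <= #|V| -> #|S| <= 5 ->
    #|e| = 3 -> #|f| = 3 -> #|g| = 3 ->
    e \subset S -> f \subset S -> g \subset S ->
  [\/ col e = col f, col e = col g | col f = col g].
Proof.
move=> free V5 S5 e3 f3 g3 eS fS gS.
have [|S' SS' S'5] := @ex_superset _ S 5; first by rewrite S5.
have {}eS := subset_trans eS SS'; have {}fS := subset_trans fS SS'.
have {}gS := subset_trans gS SS'.
have two := @skew_triples_two_colors V K col S' _ _ _ free (eq_leq S'5).
have efU : 6 - #|e :&: f| <= 5.
  have: #|e :|: f| <= 5 by rewrite -S'5 subset_leq_card // subUset eS.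
  by rewrite cardsU e3 f3.
have : #|e :&: f| <= 3 by rewrite -e3 subset_leq_card ?subsetIl.
rewrite leq_eqVlt => /orP[/eqP ef3 | ].
  by constructor 1; rewrite (setI_full_eq e3 f3 ef3).
rewrite ltnS leq_eqVlt => /orP[/eqP ef2 | ef_lt2]; last first.
  by apply: two => //; move: efU ef_lt2; case: #|e :&: f| => [|[]].
(* Two triples abc and abd: the triple cdv through the fifth vertex v meets each
   of them in one vertex, and by rainbow-freeness it repeats one of their colors.
   It can therefore replace that one in the comparison with g. *)
have [a [b [c [d [U eE fE]]]]] := close_pair_names e3 f3 ef2.
have /eqP/cards1P[v vE] : #|S' :\: (e :|: f)| = 1.
  by rewrite cardsD S'5 (setIidPr _) ?subUset ?eS // cardsU e3 f3 ef2.
have /setDP[vS] : v \in S' :\: (e :|: f) by rewrite vE set11.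
rewrite inE negb_or => /andP[vNe vNf].
have Uv : uniq [:: a; b; c; d; v].
  rewrite -[_ :: _]/(rcons [:: a; b; c; d] v) rcons_uniq U andbT.
  by move: vNe vNf; rewrite eE fE !inE; case_vertices.
pose h := [set c; d; v].
have h3 : #|h| = 3 by apply: cards3; have := drop_uniq 2 Uv.
have hS : h \subset S'.
  apply/subsetP => x; rewrite !inE => /orP[/orP[]|] /eqP-> //.
    by apply: (subsetP eS); rewrite eE !inE eqxx orbT.
  by apply: (subsetP fS); rewrite fE !inE eqxx orbT.
have [] := free _ _ _ _ _ Uv; rewrite -?eE -?fE -/h.
- by constructor 1.
- move=> eh.
  have fh1 : #|f :&: h| = 1.
    rewrite fE /h (set3_swap c); apply: skew_pair_meet.
    by rewrite (perm_uniq (_ : perm_eq _ [:: a; b; c; d; v])) //; permute_vertices.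
  have [] := two f h g f3 h3 g3 fS hS gS fh1; rewrite -?eh => ?.
  + by constructor 1.
  + by constructor 3.
  + by constructor 2.
- move=> fh; have eh1 : #|e :&: h| = 1 by rewrite eE; apply: skew_pair_meet.
  have [] := two e h g e3 h3 g3 eS hS gS eh1; rewrite -?fh => ?.
  + by constructor 1.
  + by constructor 2.
  + by constructor 3.
Qed.

(** * Vertices that see only two colors *)

(** Suppose that g has a third color. Then g does not contain b, since otherwise
    abc, abd and g lie in a set of five vertices. So g = axy with x, y different
    from b, and abx lies together with any two of abc, abd, g in a set of five
    vertices. Its color then belongs to each of the three pairs of colors taken
    from these triples, which have no common element. *)
Lemma third_color_avoids (V : finType) (K : eqType) (col : {set V} -> K)
    a b c d (g : {set V}) :
    rainbowF5_free col -> 5 <= #|V| -> uniq [:: a; b; c; d] ->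
    col [set a; b; c] != col [set a; b; d] -> #|g| = 3 -> a \in g ->
  col g \in [:: col [set a; b; c]; col [set a; b; d]].
Proof.
move=> free V5 U ef g3 ag.
have [ab e3 f3] : [/\ a != b, #|[set a; b; c]| = 3 & #|[set a; b; d]| = 3].
  move: U; rewrite /= !inE !negb_or => /and4P[/and3P[ab ac ad] /andP[bc bd] _ _].
  by rewrite !cards3 //= !inE !negb_or ab ?ac ?bc ?ad ?bd.
have two S (h1 h2 h3 : {set V}) := @two_colors_of_card5 V K col S h1 h2 h3 free V5.
have cardU2 (A : {set V}) x y : #|A| = 3 -> #|A :|: [set x; y]| <= 5.
  by move=> A3; rewrite (leq_trans (leq_card_setU _ _)) // A3 cards2; case: eqP.
apply: contraR ef; rewrite !inE negb_or => /andP[ge gf].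
have [bg|bNg] := boolP (b \in g).
  have [|||->//|E|E] := two _ _ _ _ (cardU2 g c d g3) e3 f3 g3.
  - by apply: sub3set; rewrite !inE ?ag ?bg ?eqxx ?orbT.
  - by apply: sub3set; rewrite !inE ?ag ?bg ?eqxx ?orbT.
  - exact: subsetUl.
  - by rewrite E eqxx in ge.
  - by rewrite E eqxx in gf.
(* Here x is either of the two vertices of g other than a, and g together with b
   and c (or d) covers abx and abc (or abd). *)
have [x /setD1P[xa xg]] : exists x, x \in g :\ a.
  by apply/card_gt0P; have := cardsD1 a g; rewrite g3 ag add1n => -[<-].
have h3 : #|[set a; b; x]| = 3.
  by apply: cards3; rewrite /= !inE negb_or ab ![_ == x]eq_sym xa (memPn bNg).
have hg y : #|[set a; b; y]| = 3 -> col g != col [set a; b; y] ->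
    col [set a; b; x] = col [set a; b; y] \/ col [set a; b; x] = col g.
  move=> y3 gy; have [|||E|E|E] := two _ _ _ _ (cardU2 g b y g3) y3 g3 h3.
  - by apply: sub3set; rewrite !inE ?ag ?xg ?eqxx ?orbT.
  - exact: subsetUl.
  - by apply: sub3set; rewrite !inE ?ag ?xg ?eqxx ?orbT.
  - by rewrite E eqxx in gy.
  - by left.
  - by right.
have [|||->//|E|E] := two _ _ _ _ (cardU2 _ c d h3) e3 f3 h3.
- by apply: sub3set; rewrite !inE ?ag ?xg ?eqxx ?orbT.
- by apply: sub3set; rewrite !inE ?ag ?xg ?eqxx ?orbT.
- exact: subsetUl.
- by have [<-|E'] := hg d f3 gf; rewrite E // E' eqxx in ge *.
- by have [<-|E'] := hg c e3 ge; rewrite E // E' eqxx in gf *.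
Qed.

(** Turns two intersecting triples of different colors into a vertex that sees
    no other color. This is the form in which local information is passed to
    the global argument below. *)
Lemma bicolored_vertex (V : finType) (K : eqType) (col : {set V} -> K)
    (e f : {set V}) :
    rainbowF5_free col -> 5 <= #|V| -> #|e| = 3 -> #|f| = 3 ->
    col e != col f -> ~~ [disjoint e & f] ->
  exists a, forall g : {set V}, #|g| = 3 -> a \in g -> col g \in [:: col e; col f].
Proof.
move=> free V5 e3 f3 ef meet.
have : 0 < #|e :&: f| by rewrite card_gt0 setI_eq0.
have : #|e :&: f| <= 3 by rewrite -e3 subset_leq_card ?subsetIl.
rewrite leq_eqVlt => /orP[/eqP ef3 | ].
  by rewrite (setI_full_eq e3 f3 ef3) eqxx in ef.
rewrite ltnS leq_eqVlt => /orP[/eqP ef2 _| ef_lt2 ef_gt0].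
  have [a [b [c [d [U eE fE]]]]] := close_pair_names e3 f3 ef2.
  by rewrite eE fE in ef *; exists a => g; apply: third_color_avoids U ef.
have /(skew_pair_names e3 f3)[a [b [c [d [e' [U eE fE]]]]]] : #|e :&: f| = 1.
  by apply/eqP; rewrite eqn_leq -ltnS ef_lt2.
rewrite {}eE {}fE in ef *.
have Up s : perm_eq s [:: a; b; c; d; e'] -> uniq s by move/perm_uniq->.
(* Here e = abc and f = cde'. The triple acd shares two vertices with each of
   them and repeats the color of one, so it forms a differently colored pair
   with two common vertices together with the other. *)
have [E|E|E] := skew_pair_cross free U; first by rewrite E eqxx in ef.
  have U' : uniq [:: c; d; a; e'].
    by have /(drop_uniq 1) : uniq [:: b; c; d; a; e'] by apply: Up; permute_vertices.
  rewrite E set3_rot in ef *.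
  by exists c => g; apply: third_color_avoids U' ef.
have U' : uniq [:: a; c; b; d].
  by have /(drop_uniq 1) : uniq [:: e'; a; c; b; d] by apply: Up; permute_vertices.
rewrite E setUAC in ef *.
by exists a => g; apply: third_color_avoids U' ef.
Qed.

(** * The upper bound *)

(** If every color failed to dominate, there would be a vertex a seeing only
    colors i and j, a vertex b seeing two colors other than i, and a vertex d
    seeing two colors other than j. A triple containing a, b and d has no
    possible color. *)
Lemma dominant_color (V : finType) (K : eqType) (col : {set V} -> K) :
    rainbowF5_free col -> 5 <= #|V| ->
  exists z, forall e f : {set V}, #|e| = 3 -> #|f| = 3 ->
    col e != z -> col f != z -> col e != col f -> [disjoint e & f].
Proof.
move=> free V5.
pose bad z := [exists e : {set V}, exists f : {set V},
  [&& #|e| == 3, #|f| == 3, col e != z, col f != z, col e != col f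
    & ~~ [disjoint e & f]]].
have goodP z : ~~ bad z -> forall e f : {set V}, #|e| = 3 -> #|f| = 3 ->
    col e != z -> col f != z -> col e != col f -> [disjoint e & f].
  move=> good e f e3 f3 ez fz ef; apply: contraR good => meet.
  by apply/existsP; exists e; apply/existsP; exists f; rewrite e3 f3 ez fz ef.
have badP z : bad z -> exists a i j, [/\ i != z, j != z &
    forall g : {set V}, #|g| = 3 -> a \in g -> col g \in [:: i; j]].
  case/existsP=> e /existsP[f /and5P[/eqP e3 /eqP f3 ez fz /andP[ef meet]]].
  have [a aP] := bicolored_vertex free V5 e3 f3 ef meet.
  by exists a, (col e), (col f).
(* If no two intersecting triples differ in color, any color will do as z; that
   of the empty set is at hand. *)
have [bad0|/goodP] := boolP (bad (col set0)); last by exists (col set0).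
have [a [i [j [_ _ aP]]]] := badP _ bad0.
have [badi|/goodP] := boolP (bad i); last by exists i.
have [b [i1 [j1 [i1i j1i bP]]]] := badP _ badi.
have [badj|/goodP] := boolP (bad j); last by exists j.
have [d [i2 [j2 [i2j j2j dP]]]] := badP _ badj.
have [|g abdg g3] := @ex_superset _ [set a; b; d] 3.
  rewrite (leq_trans _ V5) // andbT -setUA cardsU1 cards2.
  by case: (a \notin _); case: (b != d).
have [ag bg dg] : [/\ a \in g, b \in g & d \in g].
  by split; apply: (subsetP abdg); rewrite !inE eqxx ?orbT.
have := aP g g3 ag; have := bP g g3 bg; have := dP g g3 dg; rewrite !inE.
move=> gd gb /orP[] /eqP gE; rewrite gE in gd gb.
  by rewrite ![i == _]eq_sym (negbTE i1i) (negbTE j1i) in gb.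
by rewrite ![j == _]eq_sym (negbTE i2j) (negbTE j2j) in gd.
Qed.

(** Representatives of the non-dominant colors are disjoint triples. *)
Lemma rainbowF5_free_card n k (col : {ffun {set 'I_n} -> 'I_k}) :
  5 <= n -> edge_coloring col -> rainbowF5_free col -> k <= 1 + n %/ 3.
Proof.
move=> n5 /forallP surj free.
have [|z zP] := dominant_color free; first by rewrite card_ord.
have /fin_all_exists[r rP] i : exists e : {set 'I_n}, #|e| = 3 /\ col e = i.
  by have /exists_inP[e] := surj i; rewrite inE => /eqP e3 /eqP ei; exists e.
pose R i := if i == z then set0 else r i.
have disj i j : i != j -> [disjoint R i & R j].
  rewrite /R; case: (eqVneq i z) => [_|iz]; first by rewrite -setI_eq0 set0I eqxx.
  case: (eqVneq j z) => [_|jz]; first by rewrite -setI_eq0 setI0 eqxx.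
  have [ri3 ci] := rP i; have [rj3 cj] := rP j.
  by move=> ij; apply: zP; rewrite ?ci ?cj.
have k1 : k.-1 * 3 <= n.
  rewrite -[k in k.-1]card_ord -(cardC1 z) -sum_nat_const.
  rewrite -[leqRHS]card_ord; apply: leq_trans (max_card (\bigcup_i R i)).
  rewrite -sum1_card (partition_disjoint_bigcup _ (fun=> 1) disj) big_mkcond /=.
  apply: leq_sum => i _; rewrite sum1_card /R inE.
  by case: eqVneq => // _; rewrite (rP i).1.
by rewrite -leq_subLR subn1 leq_divRL.
Qed.

(** * The lower bound *)

(** The blocks {3i, 3i+1, 3i+2} receive their own colors, and all other triples
    share one more. Any two triples of F5 intersect, whereas distinct blocks
    do not, so at most one triple of a copy is a block. *)
Lemma matching_coloring n : 5 <= n -> has_rainbow_free_coloring n F5 (1 + n %/ 3).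
Proof.
move=> n5.
pose block i := [set x : 'I_n | x %/ 3 == i].
pose col : {ffun {set 'I_n} -> 'I_(1 + n %/ 3)} := [ffun e =>
  if [pick i : 'I_(n %/ 3) | e == block i] is Some i then lift ord0 i else ord0].
have colE e : col e != ord0 -> exists i : 'I_(n %/ 3), e = block i.
  by rewrite ffunE; case: pickP => [i /eqP -> _ | _ /eqP//]; exists i.
have block3 (i : 'I_(n %/ 3)) : #|block i| = 3.
  have lt_n (j : 'I_3) : i * 3 + j < n.
    have := ltn_ord i; rewrite leq_divRL // => /(leq_trans _); apply.
    by rewrite mulSn addnC ltn_add2r.
  have inj : injective (fun j => Ordinal (lt_n j)).
    by move=> j1 j2 [] /addnI /val_inj.
  rewrite -[RHS]card_ord -cardsT -(card_imset _ inj); apply: eq_card => x.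
  rewrite inE; apply/eqP/imsetP => [xi | [j _ ->] /=].
    exists (Ordinal (ltn_pmod x (isT : 0 < 3))) => //.
    by apply: val_inj; rewrite /= -xi -divn_eq.
  by rewrite divnMDl // (divn_small (ltn_ord j)) addn0.
have block_inj i j x : x \in block i -> x \in block j -> i = j.
  by rewrite !inE => /eqP <- /eqP <-.
have col_block (i : 'I_(n %/ 3)) : col (block i) = lift ord0 i.
  rewrite ffunE; case: pickP => [j /eqP ij | /(_ i)]; last by rewrite eqxx.
  have [x xi] : exists x, x \in block i by apply/card_gt0P; rewrite block3.
  by congr lift; apply/val_inj/esym/(block_inj _ _ x); rewrite -?ij.
have colI (e f : {set 'I_n}) x : x \in e -> x \in f ->
    col e != ord0 -> col f != ord0 -> col e = col f.
  move=> xe xf /colE[i ei] /colE[j fj].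
  by rewrite ei fj in xe xf *; rewrite (block_inj _ _ _ xe xf).
apply/existsP; exists col; apply/andP; split.
  apply/forallP => i; apply/exists_inP.
  case: (unliftP ord0 i) => [j -> | ->].
    by exists (block j); rewrite ?inE ?block3 ?col_block.
  pose v k (k5 : k < 5) := Ordinal (leq_trans k5 n5).
  (* The common color needs a triple that is not a block; 0 and 3 lie in different
     blocks. *)
  exists [set v 0 isT; v 1 isT; v 3 isT]; first by rewrite inE cards3.
  apply: contraTT isT => /colE[j jE].
  have v0 : v 0 isT \in block j by rewrite -jE !inE eqxx.
  have v3 : v 3 isT \in block j by rewrite -jE !inE eqxx !orbT.
  by move: v0 v3; rewrite !inE /= => /eqP <-.
apply/rainbowF5_freeP => a b c d e _.
have [e0|e0] := eqVneq (col [set a; b; c]) ord0;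
  have [f0|f0] := eqVneq (col [set a; b; d]) ord0.
- by constructor 1; rewrite e0.
- have [g0|g0] := eqVneq (col [set c; d; e]) ord0; first by constructor 2; rewrite e0.
  by constructor 3; apply: (colI _ _ d) => //; rewrite !inE eqxx ?orbT.
- have [g0|g0] := eqVneq (col [set c; d; e]) ord0; first by constructor 3; rewrite f0.
  by constructor 2; apply: (colI _ _ c) => //; rewrite !inE eqxx ?orbT.
- by constructor 1; apply: (colI _ _ a) => //; rewrite !inE eqxx ?orbT.
Qed.

Theorem corollary1p4 (n : nat) (hn : 5 <= n) : ar n F5 = 1 + n %/ 3.
Proof.
apply/eqP; rewrite eqn_leq (ar_max (matching_coloring hn)) andbT.
apply/bigmax_leqP => k /existsP[col /andP[surj /rainbowF5_freeP free]].
exact: rainbowF5_free_card surj free.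
Qed.
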